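(* Let $f:\mathbb{C}\to\mathbb{C}$ be given by $f(z)=z+1+e^{-z}$. Let $E(f)$ be the set of endpoints of the Julia set $J(f)$, let $I(f)=\{z\in\mathbb{C}: f^n(z)\to\infty\text{ as }n\to\infty\}$ be the escaping set, and let $\hat{E}(f)=E(f)\setminus I(f)$ be the set of non-escaping endpoints. Then $\hat{E}(f)\cup\{\infty\}$ is totally disconnected.
   Context: $f^n$ denotes the $n$th iterate of $f$. The Fatou set $F(f)$ is the set of points having a neighbourhood on which $(f^n)_{n\in\mathbb{N}}$ is a normal family, and the Julia set is $J(f)=\mathbb{C}\setminus F(f)$. It is known that for $f(z)=z+1+e^{-z}$ the Julia set is a Cantor bouquet: it is an uncountable union of pairwise disjoint curves, which are the connected components of $J(f)$, each of them the image of a homeomorphism $\gamma:[0,\infty)\to\gamma([0,\infty))\subset\mathbb{C}$ with $\gamma(t)\to\infty$ as $t\to\infty$. The endpoint of such a curve is the point $\gamma(0)$, and $E(f)$ is the set of all these endpoints. The set $\hat{E}(f)\cup\{\infty\}$ is regarded as a subspace of the Riemann sphere $\hat{\mathbb{C}}=\mathbb{C}\cup\{\infty\}$. A set is totally disconnected if all its connected components are single points. *)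

(* Defs.v *)
From HB Require Import structures.
From mathcomp Require Import all_boot all_order all_algebra.
From mathcomp Require Import complex.
From mathcomp Require Import all_classical all_reals all_analysis.

Set Implicit Arguments.
Unset Strict Implicit.
Unset Printing Implicit Defensive.

Import Order.TTheory GRing.Theory Num.Theory.
Import ComplexField.Normc numFieldNormedType.Exports.

Local Open Scope classical_set_scope.
Local Open Scope ring_scope.
Local Open Scope complex_scope.

(* exp(x + iy) = e^x (cos y + i sin y) *)
Definition cexp (R : realType) (z : R[i]) : R[i] :=
  (expR (complex.Re z) * cos (complex.Im z)) +i*
  (expR (complex.Re z) * sin (complex.Im z)).

(* The library puts the norm topology on an abstract numFieldType and on
   R[i]^o; inference on R[i] itself needs a copy. *)
#[export, non_forgetful_inheritance]
HB.instance Definition _ (R : realType) :=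
  PseudoPointedMetric.copy R[i] R[i]^o.

Definition riemann_sphere (R : realType) : topologicalType :=
  one_point_compactification R[i].

Definition finite_pt (R : realType) (z : R[i]) : riemann_sphere R := Some z.

Definition infty_pt (R : realType) : riemann_sphere R := None.

(* Chordal distance of the stereographic projections on the unit sphere;
   [normc] is the modulus with values in R. *)
Definition chordal (R : realType) (p q : riemann_sphere R) : R :=
  match p, q with
  | Some z, Some w =>
      2 * normc (z - w) /
      (Num.sqrt (1 + normc z ^+ 2) * Num.sqrt (1 + normc w ^+ 2))
  | Some z, None => 2 / Num.sqrt (1 + normc z ^+ 2)
  | None, Some w => 2 / Num.sqrt (1 + normc w ^+ 2)
  | None, None => 0
  end.

(* Montel's definition: every sequence in the family has a subsequence
   converging uniformly on compact subsets of U for the chordal metric; the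
   limit may take the value infinity. *)
Definition normal_family (R : realType) (U : set R[i])
    (F : set (R[i] -> R[i])) : Prop :=
  forall u : nat -> R[i] -> R[i], (forall k, F (u k)) ->
  exists2 s : nat -> nat, {homo s : m n / (m < n)%N} &
  exists g : R[i] -> riemann_sphere R,
  forall K : set R[i], compact K -> K `<=` U ->
  forall e : R, 0 < e ->
  \forall k \near \oo, forall z, K z ->
    chordal (finite_pt (u (s k) z)) (g z) < e.

Definition fatou_set (R : realType) (f : R[i] -> R[i]) : set R[i] :=
  [set z | exists2 U : set R[i], nbhs z U &
           normal_family U (range (fun n => iter n f))].

Definition julia_set (R : realType) (f : R[i] -> R[i]) : set R[i] :=
  ~` fatou_set f.

Definition escaping_set (R : realType) (f : R[i] -> R[i]) : set R[i] :=
  [set z | finite_pt (iter n f z) @[n --> \oo] --> infty_pt R].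

(* gamma restricts to a homeomorphism from [0, +oo) onto its image, with
   inverse delta; the values of gamma on negative reals are irrelevant. *)
Definition curve_to_infty (R : realType) (gamma : R -> R[i]) : Prop :=
  [/\ {within `[0, +oo[, continuous gamma},
      exists2 delta : R[i] -> R,
        {within gamma @` `[0, +oo[, continuous delta} &
        forall t, 0 <= t -> delta (gamma t) = t
    & finite_pt (gamma t) @[t --> +oo] --> infty_pt R].

(* Endpoints of the components of J(f) that are curves going to infinity. *)
Definition endpoints (R : realType) (f : R[i] -> R[i]) : set R[i] :=
  [set z | julia_set f z /\ exists2 gamma : R -> R[i],
     curve_to_infty gamma &
     gamma 0 = z /\
     connected_component (julia_set f) z = gamma @` `[0, +oo[].

(* Main.v *)
(** Let H be the half-plane Re z >= 1. It is mapped into itself and all its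
points escape, so a non-escaping orbit never meets H. Starting from any r_0,
let r_(n+1) = r_n + 2 + exp r_n and let D_n be the open square of half-side
r_n; then f maps the closure of D_n into D_(n+1). Let G_n contain the closure
of D_n and be the half-strip with left edge Re z = - (r_n + 6) and with
horizontal edges on two lines where exp (- z) > 0, so that f maps these edges
into H. On the left edge |exp (- z)| is so large that f leaves the closure of
G_(n+1) or enters H.
Let B_n be the set of z whose orbit starts in G_n, G_(n+1), ..., avoiding H,
and reaches some D_(n+k) after k steps. It is open and bounded, and B_0
contains a given non-escaping point if r_0 is large. If p is in the boundary
of B_n, then either p or f p is in H, or p is outside D_n and f p is in the
boundary of B_(n+1); since the D_n exhaust the plane, every boundary point of
B_0 escapes. Hence B_0 separates any non-escaping point from infinity within
the non-escaping set. A connected set of finite endpoints lies in one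
component of the Julia set, which is a ray and has only one endpoint. *)
Require Import Defs.
From mathcomp Require Import all_boot all_order all_algebra.
From mathcomp Require Import complex ring lra.
From mathcomp Require Import all_classical all_reals all_analysis.

Import Order.TTheory GRing.Theory Num.Theory.
Import numFieldNormedType.Exports.

Local Open Scope classical_set_scope.
Local Open Scope ring_scope.
Local Open Scope complex_scope.

(** * The topology of the complex plane *)

Section complex_topology.
Context {R : realType}.
Implicit Types (z w : R[i]) (U K : set R[i]).

Lemma normc_ltP z (e : R) : 0 < e ->
  (`|z| < e%:C) = (complex.Re z ^+ 2 + complex.Im z ^+ 2 < e ^+ 2).
Proof.
move=> e0; rewrite normc_def ltcR -{1}(ger0_norm (ltW e0)) -sqrtr_sqr ltr_sqrt //.
by rewrite exprn_gt0.
Qed.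

(** Squares replace discs here, so that later estimates treat real and imaginary parts
    separately. *)
Lemma nbhs_complexP z U : nbhs z U <->
  exists2 e : R, 0 < e & forall w, `|complex.Re w - complex.Re z| < e ->
    `|complex.Im w - complex.Im z| < e -> U w.
Proof.
split.
  move/nbhs_ballP => [[e ie] /=]; rewrite ltcE /= => /andP[/eqP -> e0] zU.
  exists (e / 2); first lra.
  case: z zU => x y zU [a b] /= ax by_; apply: zU.
  rewrite /ball /= normc_ltP //=.
  move: ax by_; rewrite !ltr_distl => /andP[? ?] /andP[? ?]; nra.
case=> e e0 eU; apply/nbhs_ballP; exists (e%:C) => /=; first by rewrite ltcR.
case: z eU => x y eU [a b]; rewrite /ball /= normc_ltP //= => h.
have yb := sqr_ge0 (y - b); have xa := sqr_ge0 (x - a).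
by apply: eU => /=; rewrite ltr_norml; apply/andP; split; nra.
Qed.

Lemma continuous_Re : continuous (@complex.Re R).
Proof.
move=> z U /nbhs_ballP[e e0 eU]; apply/nbhs_complexP; exists e => // w h _.
by apply: eU; rewrite /ball /= distrC.
Qed.

Lemma continuous_Im : continuous (@complex.Im R).
Proof.
move=> z U /nbhs_ballP[e e0 eU]; apply/nbhs_complexP; exists e => // w _ h.
by apply: eU; rewrite /ball /= distrC.
Qed.

Lemma continuous_normRe : continuous (fun z : R[i] => `|complex.Re z|).
Proof.
move=> z; apply: continuous_comp; [exact: continuous_Re|exact: norm_continuous].
Qed.

Lemma continuous_normIm : continuous (fun z : R[i] => `|complex.Im z|).
Proof.
move=> z; apply: continuous_comp; [exact: continuous_Im|exact: norm_continuous].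
Qed.

Lemma continuous_Complex (T : topologicalType) (g h : T -> R) :
  continuous g -> continuous h -> continuous (fun t => g t +i* h t).
Proof.
move=> cg ch t U /nbhs_complexP [e e0 eU].
near=> s; apply: eU => /=; rewrite distrC.
  by near: s; move/cvgrPdist_lt: (cg t); apply.
by near: s; move/cvgrPdist_lt: (ch t); apply.
Unshelve. all: by end_near. Qed.

Definition rectangle (r s : R) : set R[i] :=
  [set z | `|complex.Re z| <= r /\ `|complex.Im z| <= s].

Lemma rectangle_closed r s : closed (rectangle r s).
Proof.
apply: closedI.
  apply: (@closed_comp _ _ (fun z => `|complex.Re z|) [set x | x <= r]).
    by move=> z _; exact: continuous_normRe.
  exact: closed_le.
apply: (@closed_comp _ _ (fun z => `|complex.Im z|) [set x | x <= s]).
  by move=> z _; exact: continuous_normIm.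
exact: closed_le.
Qed.

Lemma rectangle_compact r s : compact (rectangle r s).
Proof.
have -> : rectangle r s =
    (fun p : R * R => p.1 +i* p.2) @` (`[- r, r] `*` `[- s, s]).
  apply/seteqP; split=> [[x y] [/= xr ys]|_ [[x y] [/= xr ys] <-]].
    by exists (x, y) => //; split; rewrite /= in_itv /= -ler_norml.
  by move: xr ys; rewrite /rectangle /= !in_itv /= -!ler_norml.
apply: continuous_compact.
  apply: continuous_subspaceT; apply: continuous_Complex.
    by move=> p; apply: cvg_fst.
  by move=> p; apply: cvg_snd.
by apply: compact_setX; exact: segment_compact.
Qed.

Lemma compact_complex_bounded K : compact K -> exists r, K `<=` rectangle r r.
Proof.
move=> cK.
have bnd (g : R[i] -> R) : continuous g -> exists r, forall z, K z -> `|g z| <= r.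
  move=> cg.
  have /compact_bounded : compact (g @` K).
    by apply: continuous_compact => //; exact: continuous_subspaceT.
  case=> r [_ rg]; exists (r + 1) => z Kz.
  by apply: (rg (r + 1)); [rewrite ltrDl|exists z].
have [r Rr] := bnd _ continuous_Re; have [s Is] := bnd _ continuous_Im.
exists (Num.max r s) => z Kz; split; rewrite le_max.
  by rewrite Rr.
by rewrite Is // orbT.
Qed.

End complex_topology.

(** * The orbits of Fatou's function *)

Section fatou_function.
Context {R : realType}.
Implicit Types (z w p : R[i]) (x y r : R).

Definition fatou_map z := z + 1 + cexp (- z).
Local Notation f := fatou_map.

Lemma Re_fatou_map z : complex.Re (f z) =
  complex.Re z + 1 + expR (- complex.Re z) * cos (complex.Im z).
Proof. by case: z => x y; rewrite /fatou_map /cexp /= cosN. Qed.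

Lemma Im_fatou_map z : complex.Im (f z) =
  complex.Im z - expR (- complex.Re z) * sin (complex.Im z).
Proof. by case: z => x y; rewrite /fatou_map /cexp /= sinN mulrN addr0. Qed.

Lemma continuous_fatou_map : continuous f.
Proof.
have -> : f = fun z => complex.Re (f z) +i* complex.Im (f z).
  by apply/funext => z; case: (f z).
have cN z : {for z, continuous (fun w : R[i] => - complex.Re w)}.
  by apply: continuousN; exact: continuous_Re.
have cE z : {for z, continuous (fun w : R[i] => expR (- complex.Re w))}.
  exact: continuous_comp (cN z) (@continuous_expR R _).
have c1 z : {for z, continuous (fun w : R[i] => complex.Re w + 1)}.
  by apply: continuousD; [exact: continuous_Re|exact: cst_continuous].
apply: continuous_Complex => z.
  under eq_fun do rewrite Re_fatou_map.
  apply: (continuousD (c1 z)); apply: (continuousM (cE z)).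
  apply: continuous_comp; [exact: continuous_Im|exact: continuous_cos].
under eq_fun do rewrite Im_fatou_map.
apply: (continuousB (@continuous_Im R z)); apply: (continuousM (cE z)).
apply: continuous_comp; [exact: continuous_Im|exact: continuous_sin].
Qed.

(** A neighbourhood of infinity contains the complement of a compact set, and that compact set lies
    in some square. *)
Lemma escapingP (g : R[i] -> R[i]) z :
  (forall r, exists N, forall n, (N <= n)%N -> ~ rectangle r r (iter n g z)) ->
  escaping_set g z.
Proof.
move=> esc U [K [cK _] KU].
have [r Kr] := compact_complex_bounded _ cK; have [N Nr] := esc r.
exists N => // n /= /Nr nr; apply: KU; left.
by exists (iter n g z) => // /Kr.
Qed.

(** * A half-plane of escaping points *)

Definition far_right : set R[i] := [set z | 1 <= complex.Re z].

Lemma far_right_closed : closed far_right.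
Proof.
apply: (@closed_comp _ _ (@complex.Re R) [set x | 1 <= x]).
  by move=> z _; exact: continuous_Re.
exact: closed_ge.
Qed.

Lemma abs_expRM_cos_sin x y :
  `|expR x * cos y| <= expR x /\ `|expR x * sin y| <= expR x.
Proof.
have e0 := expR_gt0 x.
by split; rewrite ler_norml; apply/andP; split;
  have := cos_le1 y; have := cos_geN1 y; have := sin_le1 y; have := sin_geN1 y; nra.
Qed.

(** Here e^x >= 1 + x >= 2, so exp (- z) has modulus at most 1/2 and cancels at most half of the
    translation by 1. *)
Lemma Re_fatou_map_far_right z :
  far_right z -> complex.Re z + 1 / 2 <= complex.Re (f z).
Proof.
rewrite /far_right /= Re_fatou_map => x1.
have [+ _] := abs_expRM_cos_sin (- complex.Re z) (complex.Im z).
have : expR (- complex.Re z) <= 1 / 2.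
  have ex := expR_ge1Dx (complex.Re z); have := expRxMexpNx_1 (complex.Re z).
  have := expR_gt0 (- complex.Re z).
  have {}ex : 2 <= expR (complex.Re z) by lra.
  nra.
by rewrite ler_norml => h /andP[]; lra.
Qed.

Lemma far_right_escaping z k : far_right (iter k f z) -> escaping_set f z.
Proof.
move=> Hk.
have rk n : 1 + n%:R / 2 <= complex.Re (iter (n + k) f z).
  elim: n => [|n IH]; first by rewrite mul0r addr0.
  have : far_right (iter (n + k) f z).
    by rewrite /far_right /=; have := ler0n R n; lra.
  by move/Re_fatou_map_far_right; rewrite addSn iterS -[n.+1%:R]natr1; lra.
(* After time k the real part gains 1/2 per step, so more than 2 |r| further steps carry it beyond
   r. *)
apply: escapingP => r; exists (Num.bound `|(r * 2)%R|%R + k)%N => n Nn.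
rewrite -(subnK (leq_trans (leq_addl _ _) Nn)) => -[+ _].
rewrite ler_norml => /andP[_].
have : r * 2 < (n - k)%:R; last by have := rk (n - k)%N; lra.
apply: (le_lt_trans (ler_norm _)).
apply: (lt_le_trans (archi_boundP (normr_ge0 _))).
by rewrite ler_nat -(leq_add2r k) subnK // (leq_trans (leq_addl _ _) Nn).
Qed.

(** * Squares and half-strips *)

Fixpoint radius r n : R :=
  if n is m.+1 then radius r m + 2 + expR (radius r m) else r.

(** Linear growth is enough for the squares to exhaust the plane. *)
Lemma radius_ge r n : r + n%:R * 2 <= radius r n.
Proof.
elim: n => [|n IH]; first by rewrite mul0r addr0.
by rewrite -[n.+1%:R]natr1 /=; have := expR_gt0 (radius r n); lra.
Qed.

Lemma radius_ge0 r n : 0 <= r -> 0 <= radius r n.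
Proof. by move=> r0; have := radius_ge r n; have := ler0n R n; lra. Qed.

Lemma fatou_map_rectangle r z : rectangle r r z ->
  `|complex.Re (f z)| < r + 2 + expR r /\ `|complex.Im (f z)| < r + 2 + expR r.
Proof.
case=> zr zi; have [ec es] := abs_expRM_cos_sin (- complex.Re z) (complex.Im z).
have er : expR (- complex.Re z) <= expR r.
  by rewrite ler_expR; move: zr; rewrite ler_norml => /andP[]; lra.
rewrite Re_fatou_map Im_fatou_map; move: zr zi ec es.
rewrite !ler_norml => /andP[? ?] /andP[? ?] /andP[? ?] /andP[? ?].
by split; rewrite ltr_norml; apply/andP; split; lra.
Qed.

(* A multiple of 2 pi, so that exp (- z) > 0 when |Im z| = height x. *)
Definition height x : R := pi *+ 2 *+ (Num.trunc (x / (pi *+ 2))).+1.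

(** The excess over x is at most one period, and 2 pi < 8. *)
Lemma heightP x : 0 <= x -> x < height x <= x + 8.
Proof.
rewrite /height; set P := pi *+ 2 => x0.
have /andP[P0 P8] : 0 < P <= 8.
  by rewrite /P mulr2n; have := pi_gt0 R; have := pihalf_lt2 R; lra.
have /truncn_itv/andP[] : 0 <= x / P by rewrite divr_ge0 // ltW.
rewrite -[P *+ _]mulr_natl ltr_pdivrMr // ler_pdivlMr //.
by rewrite -[_.+1%:R]natr1; lra.
Qed.

Lemma fatou_map_height x z : `|complex.Im z| = height x -> far_right (f z).
Proof.
move=> h; rewrite /far_right /= Re_fatou_map.
have -> : cos (complex.Im z) = 1.
  have -> : cos (complex.Im z) = cos `|complex.Im z|.
    by case: (ger0P (complex.Im z)) => _; rewrite ?cosN.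
  by rewrite h /height -[_ *+ _]add0r (periodicn (@cosD2pi R)) cos0.
by have := expR_ge1Dx (- complex.Re z); lra.
Qed.

Definition half_strip r : set R[i] :=
  [set z | - (r + 6) < complex.Re z /\ `|complex.Im z| < height r].

Definition closed_half_strip r : set R[i] :=
  [set z | - (r + 6) <= complex.Re z /\ `|complex.Im z| <= height r].

(** If [f z] were in the closed half-strip but outside [far_right], the real and imaginary parts of
    exp (- z) would both be at most 36 e^r in absolute value. But its modulus e^(r + 6) is at least
    64 e^r, and 2 * 36^2 < 64^2. *)
Lemma fatou_map_left_edge r z : 0 <= r -> complex.Re z = - (r + 6) ->
    `|complex.Im z| <= height r -> closed_half_strip (r + 2 + expR r) (f z) ->
  far_right (f z).
Proof.
move=> r0 zr zi [fr fi]; rewrite /far_right /= leNgt; apply/negP => f1.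
move: fr fi f1; rewrite Re_fatou_map Im_fatou_map zr opprK.
set y := complex.Im z in zi *; have := cos2Dsin2 y.
have /andP[_ h1] := heightP _ r0.
have er := expR_ge1Dx r.
have /heightP/andP[_ h2] : 0 <= r + 2 + expR r by lra.
move: zi; rewrite !ler_norml => /andP[y1 y2] cs fr /andP[s1 s2] f1.
(* The margin 6 of the left edge serves this bound: e >= 2 gives e^6 >= 64. *)
have e6 : 64 * expR r <= expR (r + 6).
  have e1 : 2 <= expR (1 : R) by have := expR_ge1Dx (1 : R); lra.
  have -> : expR (r + 6) = expR 1 ^+ 6 * expR r by rewrite -expRM_natl -expRD addrC mulr1.
  rewrite ler_pM2r ?expR_gt0 //.
  have -> : 64 = 2 ^+ 6 :> R by ring.
  by rewrite lerXn2r ?nnegrE ?expR_ge0.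
set E := expR (r + 6) in e6 fr s1 s2 f1.
set M := 36 * expR r.
(* All other terms are linear in r and e^r, and 1 + r <= e^r; the constant 36 leaves slack. *)
have c1 : - M <= E * cos y <= M by rewrite /M; apply/andP; split; lra.
have c2 : - M <= E * sin y <= M by rewrite /M; apply/andP; split; lra.
have : (E * cos y) ^+ 2 <= M ^+ 2 by case/andP: c1; nra.
have : (E * sin y) ^+ 2 <= M ^+ 2 by case/andP: c2; nra.
have : (E * cos y) ^+ 2 + (E * sin y) ^+ 2 = E ^+ 2.
  by rewrite !exprMn -mulrDr cs mulr1.
have : (64 * expR r) ^+ 2 <= E ^+ 2 by rewrite ler_sqr ?nnegrE ?mulr_ge0 ?expR_ge0.
rewrite /M !exprMn; have := exprn_gt0 2 (expR_gt0 r); lra.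
Qed.

(** * The sets B_n and their boundaries *)

Definition open_square r : set R[i] :=
  [set z | `|complex.Re z| < r /\ `|complex.Im z| < r].

(* [basin r n] is the set B_n for r_0 = r. *)
Inductive basin r : nat -> R[i] -> Prop :=
| basin_square n z : open_square (radius r n) z -> ~ far_right z -> basin r n z
| basin_step n z : half_strip (radius r n) z -> ~ far_right z ->
    basin r n.+1 (f z) -> basin r n z.

Lemma open_square_open r : open (open_square r).
Proof.
apply: openI.
  apply: (@open_comp _ _ (fun z => `|complex.Re z|) [set x | x < r]).
    by move=> z _; exact: continuous_normRe.
  exact: open_lt.
apply: (@open_comp _ _ (fun z => `|complex.Im z|) [set x | x < r]).
  by move=> z _; exact: continuous_normIm.
exact: open_lt.
Qed.

Lemma half_strip_open r : open (half_strip r).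
Proof.
apply: openI.
  apply: (@open_comp _ _ (@complex.Re R) [set x | - (r + 6) < x]).
    by move=> z _; exact: continuous_Re.
  exact: open_gt.
apply: (@open_comp _ _ (fun z => `|complex.Im z|) [set x | x < height r]).
  by move=> z _; exact: continuous_normIm.
exact: open_lt.
Qed.

Lemma closed_half_strip_closed r : closed (closed_half_strip r).
Proof.
apply: closedI.
  apply: (@closed_comp _ _ (@complex.Re R) [set x | - (r + 6) <= x]).
    by move=> z _; exact: continuous_Re.
  exact: closed_ge.
apply: (@closed_comp _ _ (fun z => `|complex.Im z|) [set x | x <= height r]).
  by move=> z _; exact: continuous_normIm.
exact: closed_le.
Qed.

Lemma open_square_half_strip r : 0 <= r -> open_square r `<=` half_strip r.
Proof.
move=> r0 z [zr zi]; have /andP[rh _] := heightP _ r0.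
split; last exact: lt_trans rh.
by move: zr; rewrite ltr_norml => /andP[]; lra.
Qed.

Lemma rectangle_half_strip r : 0 <= r -> rectangle r r `<=` half_strip r.
Proof.
move=> r0 z [zr zi]; have /andP[rh _] := heightP _ r0.
split; last exact: le_lt_trans rh.
by move: zr; rewrite ler_norml => /andP[]; lra.
Qed.

Lemma half_strip_closed_half_strip r : half_strip r `<=` closed_half_strip r.
Proof. by move=> z [/ltW zr /ltW zi]. Qed.

Lemma basin_half_strip r n z : 0 <= r -> basin r n z -> half_strip (radius r n) z.
Proof.
move=> r0 h; have := radius_ge0 _ n r0.
by case: h => // {}n {}z zD _ rn; exact: open_square_half_strip.
Qed.

Lemma basin_not_far_right r n z : basin r n z -> ~ far_right z.
Proof. by case. Qed.

(** A point reaches its square in finitely many steps, each subject to open conditions; induction on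
    the derivation pulls neighbourhoods back along [f]. *)
Lemma basin_open r n : open (basin r n).
Proof.
rewrite openE => z; elim=> {}n {}z.
  move=> zD zH; have : nbhs z (open_square (radius r n) `&` ~` far_right).
    apply: open_nbhs_nbhs; split; last by split.
    by apply: openI; [exact: open_square_open|exact/closed_openC/far_right_closed].
  by apply: filterS => w [? ?]; exact: basin_square.
move=> zG zH _ IH.
have zGH : nbhs z (half_strip (radius r n) `&` ~` far_right).
  apply: open_nbhs_nbhs; split; last by split.
  by apply: openI; [exact: half_strip_open|exact/closed_openC/far_right_closed].
have zB : nbhs z (f @^-1` basin r n.+1) by exact: continuous_fatou_map.
by apply: filterS (filterI zGH zB) => w [[wG wH] wB]; exact: basin_step wG wH wB.
Qed.

Lemma closure_basin r n p : 0 <= r -> closure (basin r n) p ->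
  closed_half_strip (radius r n) p.
Proof.
move=> r0; have /closure_id -> := closed_half_strip_closed (radius r n).
by apply: closureS => z /(basin_half_strip _ _ _ r0)/half_strip_closed_half_strip.
Qed.

Lemma basin_boundary r n p : 0 <= r -> closure (basin r n) p ->
    ~ basin r n p -> ~ far_right p -> ~ far_right (f p) ->
  [/\ ~ open_square (radius r n) p, closure (basin r n.+1) (f p) &
      ~ basin r n.+1 (f p)].
Proof.
move=> r0 cp np pH fpH; have rn := radius_ge0 _ n r0.
have nsq : ~ open_square (radius r n) p by move=> ?; apply: np; exact: basin_square.
have nstep : half_strip (radius r n) p -> ~ basin r n.+1 (f p).
  by move=> ? ?; apply: np; exact: basin_step.
(* The two pieces come from the two constructors of [basin], and closure distributes over their
   union. *)
have : closure (open_square (radius r n) `|`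
    (half_strip (radius r n) `&` f @^-1` (basin r n.+1))) p.
  by apply: closureS cp => z; case; [left|right].
rewrite closureU => -[sq|/closureI[_ cf]].
  (* A point of the closed square lies in the half-strip and is mapped into the next open square, so
     it would belong to the basin. *)
  have {}sq : rectangle (radius r n) (radius r n) p.
    have /closure_id -> := @rectangle_closed R (radius r n) (radius r n).
    by apply: closureS sq => z [/ltW ? /ltW ?].
  case: (nstep (rectangle_half_strip _ rn _ sq)).
  by apply: basin_square => //; exact: fatou_map_rectangle.
have {}cf : closure (basin r n.+1) (f p).
  by move=> V /(continuous_fatou_map p)/cf[z [? ?]]; exists (f z).
split => //; apply: nstep.
(* Only the edges of the half-strip remain to be excluded, and on each of them [f p] would be in
   [far_right]. *)
have [pr pi] := closure_basin _ _ _ r0 cp; split; rewrite lt_neqAle ?pr ?pi andbT.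
  apply/eqP => e; apply: fpH; apply: (fatou_map_left_edge (radius r n)) => //.
  exact: (closure_basin _ _ _ r0 cf).
by apply/eqP => /fatou_map_height.
Qed.

Lemma basin_boundary_escaping r p : 0 <= r ->
  closure (basin r 0) p -> ~ basin r 0 p -> escaping_set f p.
Proof.
move=> r0 cp np; have [[k Hk]|H] := pselect (exists k, far_right (iter k f p)).
  exact: far_right_escaping Hk.
have {}H k : ~ far_right (iter k f p) by move=> Hk; apply: H; exists k.
(* The orbit passes from the boundary of each B_n to that of B_(n+1), always outside the square
   D_n. *)
have bd n : closure (basin r n) (iter n f p) /\ ~ basin r n (iter n f p).
  elim: n => [//|n [cn nn]].
  by have [] := basin_boundary _ _ _ r0 cn nn (H n) (H n.+1).
apply: escapingP => s; exists (Num.bound `|s|%R) => n sn [pr pi].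
have [cn nn] := bd n.
have [+ _ _] := basin_boundary _ _ _ r0 cn nn (H n) (H n.+1); apply.
suff : s < radius r n by move=> h; split; exact: le_lt_trans h.
have : s < n%:R; last by have := radius_ge r n; have := ler0n R n; lra.
apply: (le_lt_trans (ler_norm _)).
apply: (lt_le_trans (archi_boundP (normr_ge0 _))).
by rewrite ler_nat.
Qed.

Lemma basin_bounded r : 0 <= r ->
  basin r 0 `<=` rectangle (r + 7) (r + 8).
Proof.
move=> r0 z zB; have [zr zi] := basin_half_strip _ _ _ r0 zB.
have /negP := basin_not_far_right _ _ _ zB; rewrite -ltNge => z1.
have /andP[_ h8] := heightP _ r0; split; last exact: ltW (lt_le_trans zi h8).
by move: zr => /=; rewrite ler_norml => ?; apply/andP; split; lra.
Qed.

Lemma nonescaping_basin z : ~ escaping_set f z ->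
  exists2 r, 0 <= r & basin r 0 z.
Proof.
move=> nz; exists (`|complex.Re z| + `|complex.Im z| + 1).
  by have := normr_ge0 (complex.Re z); have := normr_ge0 (complex.Im z); lra.
apply: basin_square; last by move=> /(far_right_escaping z 0).
by split=> /=; have := normr_ge0 (complex.Re z); have := normr_ge0 (complex.Im z); lra.
Qed.

(** In this form, [U] cuts out a clopen part of any set made of non-escaping points and infinity. *)
Lemma nonescaping_separated z : ~ escaping_set f z ->
  exists U : set (riemann_sphere R), [/\ open U, U (finite_pt z),
    ~ closure U (infty_pt R) &
    forall w, closure U (finite_pt w) -> ~ U (finite_pt w) -> escaping_set f w].
Proof.
move=> /nonescaping_basin[r r0 zB].
exists (@finite_pt R @` basin r 0); split.
- exact: (one_point_compactification_open_some _ (basin_open _ _)).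
- by exists z.
- have : nbhs (infty_pt R) (Some @` (~` rectangle (r + 7) (r + 8)) `|` [set None]).
    exists (rectangle (r + 7) (r + 8)) => //.
    by split; [exact: rectangle_compact|exact: rectangle_closed].
  move=> /[swap] /[apply] -[_ [[w wB <-]]] [|//] [w' + [ww']].
  by apply; rewrite ww'; exact: basin_bounded.
- move=> w cw nw; apply: (basin_boundary_escaping _ _ r0); last first.
    by move=> wB; apply: nw; exists w.
  move=> V Vw; have : nbhs (finite_pt w) (@finite_pt R @` V).
    exact: (one_point_compactification_some_nbhs _ _ Vw).
  by move=> /cw [_ [[v vB <-] [v' Vv' [vv']]]]; exists v; split=> //; rewrite -vv'.
Qed.

End fatou_function.

(** * Components in the plane and in the sphere *)

Section plane_curves.
Context {R : realType}.

(** The endpoint is independent of the parametrization: the change of parameter [dh \o g] is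
    continuous and injective on the half-line, hence strictly monotone, and it is nonnegative with a
    zero. *)
Lemma curve_to_infty_start (g h : R -> R[i]) : curve_to_infty g ->
  curve_to_infty h -> g @` `[0, +oo[ = h @` `[0, +oo[ -> g 0 = h 0.
Proof.
move=> [cg [dg _ dgK] _] [_ [dh cdh dhK] _] gh.
have hin t : 0 <= t -> exists2 s, 0 <= s & g s = h t.
  move=> t0; have : (h @` `[0, +oo[) (h t) by exists t => //=; rewrite in_itv /= t0.
  by rewrite -gh => -[s]; rewrite /= in_itv /= andbT; exists s.
have gin s : 0 <= s -> exists2 t, 0 <= t & h t = g s.
  move=> s0; have : (g @` `[0, +oo[) (g s) by exists s => //=; rewrite in_itv /= s0.
  by rewrite gh => -[t]; rewrite /= in_itv /= andbT; exists t.
have phi_ge0 s : 0 <= s -> 0 <= dh (g s) by move=> /gin[t t0 <-]; rewrite dhK.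
have phiK s : 0 <= s -> h (dh (g s)) = g s by move=> /gin[t t0 <-]; rewrite dhK.
have cphi : {within `[0, +oo[, continuous (dh \o g)}.
  apply/subspace_continuousP => s s0.
  move/subspace_continuousP: cdh => /(_ (g s)).
  rewrite -gh => /(_ (ex_intro2 _ _ s s0 erefl)) cdh.
  move/subspace_continuousP: cg => /(_ s s0) cg U /cdh/cg gU.
  have {}gU : nbhs s [set t | [set` `[0, +oo[] t -> (g @` `[0, +oo[) (g t) ->
    U (dh (g t))] := gU.
  rewrite /=; apply: (filterS _ gU) => t tU t0.
  by apply: tU => //; exists t.
have phi_inj : {in `[0, +oo[ &, injective (dh \o g)}.
  move=> s t; rewrite !in_itv /= !andbT => s0 t0 e.
  by rewrite -(dgK s) // -(phiK s) // e phiK // dgK.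
have [t t0 gt] := hin 0 (lexx _).
have pt : dh (g t) = 0 by rewrite gt dhK.
rewrite -(phiK 0) //; congr h; apply/eqP; rewrite eq_le phi_ge0 // andbT.
have I0 (s : R) : 0 <= s -> s \in `[0, +oo[ by move=> ?; rewrite in_itv /= andbT.
have [inc|dec] := itv_continuous_inj_mono cphi phi_inj.
- have [t_eq0|t_neq0] := eqVneq t 0; first by rewrite -{2}pt t_eq0.
  have := inc 0 t (I0 _ (lexx _)) (I0 _ t0).
  by rewrite lt_neqAle eq_sym t_neq0 t0 /= pt => /(_ isT)/ltW.
(* A decreasing change of parameter would be negative beyond its zero [t]. *)
- have t1 : 0 <= t + 1 by rewrite addr_ge0.
  have := dec (t + 1) t (I0 _ t1) (I0 _ t0); rewrite ltrDl ltr01 => /(_ isT) /=.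
  by rewrite pt ltNge phi_ge0.
Qed.

(** A relatively clopen part of the preimage of [S] in the plane has a relatively clopen image in
    [S]. *)
Lemma connected_component_preimage_finite (X : set R[i])
    (S : set (riemann_sphere R)) z w :
  connected S -> S `<=` @finite_pt R @` X -> S (finite_pt z) -> S (finite_pt w) ->
  connected_component X z w.
Proof.
move=> cS SX Sz Sw; exists (@finite_pt R @^-1` S) => //; split => //.
  by move=> x /SX[y Xy [<-]].
move=> B [b Bb] [C oC BC] [D cD BD].
have imgB : (@finite_pt R @` B) = S.
  apply: cS.
  - by exists (finite_pt b), b.
  - exists (@finite_pt R @` C); first exact: one_point_compactification_open_some.
    rewrite BC; apply/seteqP; split=> [_ [x [Sx Cx] <-]|x [Sx [y Cy yx]]].
      by split => //; exists x.
    by exists y => //; split => //; rewrite /preimage /= yx.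
  (* The image of an unbounded closed set is not closed in the sphere. This witness adds infinity to
     it, which is harmless because [S] contains only finite points. *)
  - exists (~` (@finite_pt R @` (~` D))).
      by apply/open_closedC/one_point_compactification_open_some/closed_openC.
    rewrite BD; apply/seteqP; split=> [_ [x [Sx Dx] <-]|x [Sx nD]].
      by split => // -[y nDy [yx]]; apply: nDy; rewrite yx.
    have [y _ yx] := SX _ Sx; exists y => //; rewrite -yx in Sx nD; split => //.
    by apply: contrapT => nDy; apply: nD; exists y.
rewrite -imgB; apply/seteqP; split => [x Bx|x [y By [<-//]]]; by exists x.
Qed.

Lemma endpoints_connected_eq (f : R[i] -> R[i]) (S : set (riemann_sphere R)) z w :
  connected S -> S `<=` @finite_pt R @` endpoints f ->
  S (finite_pt z) -> S (finite_pt w) -> z = w.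
Proof.
move=> cS SE Sz Sw.
have SJ : S `<=` @finite_pt R @` julia_set f.
  by move=> x /SE[y [Jy _] <-]; exists y.
have zw := connected_component_preimage_finite _ _ _ _ cS SJ Sz Sw.
have [z' [_ [g cg [g0 gC]]] [zE]] := SE _ Sz.
have [w' [_ [h ch [h0 hC]]] [wE]] := SE _ Sw.
rewrite -zE -wE -g0 -h0; apply: curve_to_infty_start => //.
by rewrite -gC -hC zE wE; exact: same_connected_component.
Qed.

End plane_curves.

(** * Components of the non-escaping endpoints with infinity *)

Theorem theorem5p2 (R : realType) (f : R[i] -> R[i])
    (hf : forall z : R[i], f z = z + 1 + cexp (- z)) :
  totally_disconnected
    ((@finite_pt R @` (endpoints f `\` escaping_set f)) `|` [set infty_pt R]).
Proof.
have -> : f = @fatou_map R by exact/funext.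
set A := (X in totally_disconnected X); move=> x Ax.
set S := connected_component A x.
have cS : connected S by exact: component_connected.
have SA : S `<=` A by exact: connected_component_sub.
have Sx : S x by exact: connected_component_refl.
(* Otherwise the separating set [U] would meet [S] in a nonempty clopen subset without infinity. *)
have infty_alone z : S (infty_pt R) -> ~ S (finite_pt z).
  move=> Soo Sz; have [[z' [_ nz] [zE]]|//] := SA _ Sz; rewrite {}zE in nz.
  have [U [oU Uz nUoo bU]] := nonescaping_separated z nz.
  have : S `&` U = S.
    apply: cS; first by exists (finite_pt z).
      by exists U.
    (* [U] and its closure have the same trace on [S]: the finite boundary points escape, and
       infinity is not in the closure. *)
    exists (closure U); first exact: closed_closure.
    apply/seteqP; split=> [y [Sy Uy]|y [Sy cUy]].
      by split => //; exact: subset_closure.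
    split => //; have [[w [_ nw] wy]|yoo] := SA _ Sy; last by case: nUoo; rewrite -yoo.
    by apply: contrapT => nUy; apply: nw; apply: bU; rewrite wy.
  by move=> SU; apply: nUoo; apply: subset_closure; move: Soo; rewrite -SU => -[].
apply/seteqP; split=> [y Sy|_ -> //].
(* Either infinity is the only point of the component, or the component consists of finite
   endpoints. *)
have [Soo|nSoo] := pselect (S (infty_pt R)).
  have S_infty u : S u -> u = infty_pt R by case: u => // z /(infty_alone _ Soo).
  by rewrite (S_infty _ Sx) (S_infty _ Sy).
have SE : S `<=` @finite_pt R @` endpoints (@fatou_map R).
  by move=> u Su; have [[w [Ew _] <-]|uoo] := SA _ Su; [exists w|rewrite uoo in Su].
have [z _ zx] := SE _ Sx; have [w _ wy] := SE _ Sy.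
rewrite -zx in Sx *; rewrite -wy in Sy *.
by rewrite (endpoints_connected_eq _ _ _ _ cS SE Sx Sy).
Qed.
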